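(* Let $(\mathfrak{g},J)$ be a non-complex quasi-Kähler Chern-flat Lie algebra of complex dimension $4$. Then there exists a $(1,0)$-frame $\{Z_1,\dots,Z_4\}$ on $\mathfrak{g}$ such that $$[Z_1,Z_2]=Z_{\bar 3}$$ and the other brackets involving the vectors of the frame vanish, i.e. $[Z_i,Z_j]=0$ for all $1\le i<j\le 4$ with $(i,j)\neq(1,2)$.
   Context: An almost complex Lie algebra $(\mathfrak{g},J)$ is a finite-dimensional real Lie algebra $\mathfrak{g}$ with an endomorphism $J$ satisfying $J^2=-\mathrm{I}$; its complex dimension is $\frac12\dim_{\mathbb{R}}\mathfrak{g}$. Let $\mathfrak{g}\otimes\mathbb{C}=\mathfrak{g}^{1,0}\oplus\mathfrak{g}^{0,1}$ be the splitting into the $\pm i$-eigenspaces of $J$. $(\mathfrak{g},J)$ is quasi-Kähler Chern-flat if $[\mathfrak{g}^{1,0},\mathfrak{g}^{0,1}]=0$ and $[\mathfrak{g}^{1,0},\mathfrak{g}^{1,0}]\subseteq\mathfrak{g}^{0,1}$. ''Non-complex'' means that $J$ is not integrable, i.e. $[\mathfrak{g}^{1,0},\mathfrak{g}^{1,0}]\not\subseteq\mathfrak{g}^{1,0}$. A $(1,0)$-frame is a complex basis of $\mathfrak{g}^{1,0}$, and $Z_{\bar j}:=\overline{Z_j}$. Brackets are extended complex-bilinearly; brackets $[Z_{\bar i},Z_{\bar j}]$ are the conjugates of $[Z_i,Z_j]$. *)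

(* Defs.v *)
From HB Require Import structures.
From mathcomp Require Import all_boot all_order all_algebra.
From mathcomp Require Import complex.
Set Implicit Arguments.
Unset Strict Implicit.
Unset Printing Implicit Defensive.
Import Order.TTheory GRing.Theory Num.Theory VectorInternalTheory.
Local Open Scope ring_scope.

HB.mixin Record Vector_isLieAlgebra (F : fieldType) (g : Type)
    of Vector F g := {
  lie : g -> g -> g;
  lie_linearl : forall y, linear (lie^~ y);
  lie_linearr : forall x, linear (lie x);
  liexx : forall x, lie x x = 0;
  lie_jacobi : forall x y z,
    lie x (lie y z) + lie y (lie z x) + lie z (lie x y) = 0
}.

#[short(type="lieAlgebraType")]
HB.structure Definition LieAlgebra (F : fieldType) :=
  { g of Vector F g & Vector_isLieAlgebra F g }.

Arguments lie {F s} : rename.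

(* The pair [(u, v)] stands for [u (x) 1 + v (x) i] in [V (x)_R R[i]]. *)
Definition complexification (R : rcfType) (V : lmodType R) : Type :=
  (V * V)%type.

Section ComplexificationLmodule.
Context (R : rcfType) (V : lmodType R).
Local Notation VC := (complexification V).

HB.instance Definition _ := GRing.Zmodule.copy VC (V * V)%type.

Definition complexification_scale (c : R[i]) (w : VC) : VC :=
  (complex.Re c *: w.1 - complex.Im c *: w.2,
   complex.Re c *: w.2 + complex.Im c *: w.1).

Fact complexification_scaleA a b w :
  complexification_scale a (complexification_scale b w) =
  complexification_scale (a * b) w.
Proof.
case: a b w => [a a'] [b b'] [u v]; rewrite /complexification_scale /=.
congr pair;
  rewrite !(scalerDr, scalerN, scalerDl, scaleNr, scalerA) ?opprD !addrA;
  by rewrite [LHS](ACl (1*4*2*3)).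
Qed.

Fact complexification_scale1 : left_id 1 complexification_scale.
Proof.
by case=> u v; rewrite /complexification_scale /= !scale1r !scale0r subr0 addr0.
Qed.

Fact complexification_scaleDr : right_distributive complexification_scale +%R.
Proof.
move=> c [u v] [u' v']; rewrite /complexification_scale; congr pair;
  by rewrite /= !scalerDr ?opprD addrACA.
Qed.

Fact complexification_scaleDl w :
  {morph complexification_scale^~ w : a b / a + b}.
Proof.
case: w => u v [a a'] [b b']; rewrite /complexification_scale; congr pair;
  by rewrite /= !scalerDl ?opprD addrACA.
Qed.

HB.instance Definition _ := GRing.Zmodule_isLmodule.Build R[i] VC
  complexification_scaleA complexification_scale1
  complexification_scaleDr complexification_scaleDl.

(* Complex conjugation [x (x) c |-> x (x) conj c]. *)
Definition vconj (w : VC) : VC := (w.1, - w.2).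

End ComplexificationLmodule.

Section ComplexificationVector.
Context (R : rcfType) (V : vectType R).
Local Notation VC := (complexification V).

Fact complexification_vect_iso : Vector.axiom (dim V) VC.
Proof.
pose f (w : VC) : 'rV[R[i]]_(dim V) :=
  \row_j Complex (v2r w.1 0 j) (v2r w.2 0 j).
pose f' (r : 'rV[R[i]]_(dim V)) : VC :=
  (r2v (\row_j complex.Re (r 0 j)), r2v (\row_j complex.Im (r 0 j))).
exists f.
  move=> c [u v] [u' v']; apply/rowP=> j; rewrite !mxE /= !linearD !linearN.
  rewrite !linearZ !mxE; case: c => a b /=.
  by rewrite mulrN.
exists f' => [[u v]|r].
  by rewrite /f' /f; congr pair; apply: (can_inj v2rK); rewrite r2vK;
     apply/rowP=> j; rewrite !mxE.
by apply/rowP=> j; rewrite !mxE /= !r2vK !mxE; case: (r 0 j).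
Qed.

HB.instance Definition _ :=
  Lmodule_hasFinDim.Build R[i] VC complexification_vect_iso.

Section LinearExtension.
Variable f : 'End(V).

Definition complexify_fun (w : VC) : VC := (f w.1, f w.2).

Fact complexify_fun_linear : linear complexify_fun.
Proof.
move=> c [u v] [u' v']; rewrite /complexify_fun; congr pair;
  by rewrite /= !(linearD, linearN, linearZ).
Qed.

HB.instance Definition _ :=
  GRing.isLinear.Build R[i] VC VC _ complexify_fun complexify_fun_linear.

Definition complexify_lfun : 'End(VC) := linfun complexify_fun.

End LinearExtension.
End ComplexificationVector.

Section ComplexificationLie.
Context (R : rcfType) (g : lieAlgebraType R).
Local Notation gC := (complexification g).

(* The [R[i]]-bilinear extension of the bracket of [g]. *)
Definition complexification_lie (w z : gC) : gC :=
  (lie w.1 z.1 - lie w.2 z.2, lie w.1 z.2 + lie w.2 z.1).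

Let lieDl (x y z : g) : lie (x + y) z = lie x z + lie y z.
Proof. by have := lie_linearl z 1 x y; rewrite !scale1r. Qed.
Let lieDr (x y z : g) : lie z (x + y) = lie z x + lie z y.
Proof. by have := lie_linearr z 1 x y; rewrite !scale1r. Qed.
Let lie0l (z : g) : lie 0 z = 0.
Proof. by apply: (addrI (lie 0 z)); rewrite -lieDl !addr0. Qed.
Let lie0r (z : g) : lie z 0 = 0.
Proof. by apply: (addrI (lie z 0)); rewrite -lieDr !addr0. Qed.
Let lieZl a (x z : g) : lie (a *: x) z = a *: lie x z.
Proof. by have := lie_linearl z a x 0; rewrite lie0l !addr0. Qed.
Let lieZr a (x z : g) : lie z (a *: x) = a *: lie z x.
Proof. by have := lie_linearr z a x 0; rewrite lie0r !addr0. Qed.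
Let lieNl (x z : g) : lie (- x) z = - lie x z.
Proof. by rewrite -scaleN1r lieZl scaleN1r. Qed.
Let lieNr (x z : g) : lie z (- x) = - lie z x.
Proof. by rewrite -scaleN1r lieZr scaleN1r. Qed.
Let lieC (x y : g) : lie x y = - lie y x.
Proof.
have := liexx (x + y); rewrite lieDl !lieDr !liexx add0r addr0 => /eqP.
by rewrite addr_eq0 => /eqP.
Qed.

Fact complexification_lie_linearr w : linear (complexification_lie w).
Proof.
case: w => x y c [u v] [u' v']; rewrite /complexification_lie; congr pair;
  rewrite /= !(lieDr, lieNr, lieZr) !(scalerDr, scalerN, opprD, opprK) /=.
  rewrite [LHS]addrACA; congr (_ + _); rewrite -!addrA; congr (_ + _).
  by rewrite addrA [in LHS]addrC [in RHS]addrCA addrC -!addrA; congr (_ + _).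
rewrite [LHS]addrACA; congr (_ + _); rewrite -!addrA.
by congr (_ + _); rewrite addrCA; congr (_ + _); rewrite addrC.
Qed.

Let lieCC w z : complexification_lie w z = - complexification_lie z w.
Proof.
case: w z => x y [u v]; rewrite /complexification_lie; congr pair => /=.
  by rewrite opprB lieC [lie y v]lieC opprK addrC.
by rewrite opprD lieC [lie y u]lieC addrC.
Qed.

Fact complexification_lie_linearl z : linear (complexification_lie^~ z).
Proof.
move=> c w w'; rewrite lieCC complexification_lie_linearr opprD -scalerN.
by rewrite -!lieCC.
Qed.

Fact complexification_liexx w : complexification_lie w w = 0.
Proof.
case: w => x y; rewrite /complexification_lie /= !liexx subr0.
by rewrite [lie y x]lieC subrr.
Qed.

Fact complexification_lie_jacobi w1 w2 w3 :
  complexification_lie w1 (complexification_lie w2 w3) +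
  complexification_lie w2 (complexification_lie w3 w1) +
  complexification_lie w3 (complexification_lie w1 w2) = 0.
Proof.
case: w1 w2 w3 => x y [u v] [p q]; rewrite /complexification_lie; congr pair;
  rewrite /= !(lieDr, lieNr) ?opprD !addrA.
  rewrite (ACl ((1*5*9)*(2*8*11)*(3*6*12)*(4*7*10))) /=.
  by rewrite -!opprD !lie_jacobi oppr0 !addr0.
rewrite (ACl ((1*6*11)*(2*7*9)*(3*5*10)*(4*8*12))) /=.
by rewrite -!opprD !lie_jacobi oppr0 !addr0.
Qed.

HB.instance Definition _ := Vector_isLieAlgebra.Build R[i] gC
  complexification_lie_linearl complexification_lie_linearr
  complexification_liexx complexification_lie_jacobi.

End ComplexificationLie.

Section AlmostComplex.
Context (R : rcfType) (g : lieAlgebraType R) (J : 'End(g)).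
Local Notation gC := (complexification g).

Definition almost_complex : Prop := (J \o J)%VF = - \1%VF.

Definition g10 : {vspace gC} := passmx.leigenspace (complexify_lfun J) 'i%C.
Definition g01 : {vspace gC} := passmx.leigenspace (complexify_lfun J) (- 'i%C).

(* As [C] is a subspace, an inclusion [[A, B] <= C] of a span of brackets only
   has to be stated for the brackets [lie X Y] with [X] in [A], [Y] in [B]. *)
Definition quasi_Kahler_Chern_flat : Prop :=
  {in g10 & g01, forall X Y, lie X Y = 0} /\
  {in g10 &, forall X Y, lie X Y \in g01}.

Definition integrable : Prop := {in g10 &, forall X Y, lie X Y \in g10}.

End AlmostComplex.

(* Main.v *)
From HB Require Import structures.
Require Import Defs.
From mathcomp Require Import all_boot all_order all_algebra.
From mathcomp Require Import complex reals.
From mathcomp Require Import boolp.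
Local Open Scope ring_scope.
Import GRing.Theory Num.Theory.

(** The Jacobi identity for [X], [Y] of type [(1,0)] and [conj W] of type
    [(0,1)] has two terms that contain a mixed bracket, so it reduces to
    [[conj W, [X, Y]] = 0].  Conjugating, every vector [conj [X, Y]], which has
    type [(1,0)], commutes with all of [g10] ([vconj_lie_central]).

    Non-integrability gives [X] and [Y] in [g10] with [[X, Y] <> 0]; put
    [T := conj [X, Y]], which is central in [g10].  Since [g10] has dimension 4
    ([dim_g10]), it suffices to find one more vector [U] of [g10] that commutes
    with [X] and [Y] and is not a multiple of [T]: then [X, Y, T, U] is free,
    because brackets with [X] and [Y] isolate these two vectors
    ([free_of_lie]), and the only nonzero bracket in this frame is
    [[X, Y] = conj T].  There are two cases.
    - Some [conj [A, B]] is not a multiple of [T].  It is central in [g10], so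
      it can serve as [U].
    - All brackets of [g10] lie on the line of [[X, Y]].  Then a fourth basis
      vector [W] can be corrected by multiples of [X] and [Y] so that it
      commutes with both ([exists_commuting]). *)

Section LieAlgebraTheory.
Context (F : fieldType) (g : lieAlgebraType F).
Implicit Types x y t u w : g.

HB.instance Definition _ x :=
  GRing.isLinear.Build F g g _ (lie x) (lie_linearr x).

Lemma lieC x y : lie x y = - lie y x.
Proof.
have lieDl a b c : lie (a + b) c = lie a c + lie b c :> g.
  by have := lie_linearl c 1 a b; rewrite !scale1r.
have := liexx (x + y); rewrite lieDl !linearD /= !liexx add0r addr0.
by move/addr0_eq => <-; rewrite opprK.
Qed.

Lemma span_lie_eq0 x (s : seq g) :
  {in s, forall y, lie x y = 0} -> {in <<s>>%VS, forall y, lie x y = 0}.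
Proof.
move=> s0 y ys; suff/subvP/(_ y ys) : (<<s>> <= lker (linfun (lie x)))%VS.
  by rewrite memv_ker lfunE => /eqP.
by apply/span_subvP=> z /s0 xz0; rewrite memv_ker lfunE /= xz0.
Qed.

(** [lie y] kills every vector of the family but [x], and [lie x] every vector
    after [y]: neither [x] nor [y] is in the span of its successors. *)
Lemma free_of_lie x y t u :
    lie x y != 0 -> lie x t = 0 -> lie x u = 0 -> lie y t = 0 -> lie y u = 0 ->
    t != 0 -> u \notin <[t]>%VS ->
  free [:: x; y; t; u].
Proof.
move=> xy xt xu yt yu t0 ut.
have yx : lie y x != 0 by rewrite lieC oppr_eq0.
rewrite free_cons; apply/andP; split.
  apply: contra yx => /span_lie_eq0 ->// z; rewrite !inE.
  by case/or3P=> /eqP-> //; exact: liexx.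
rewrite free_cons; apply/andP; split.
  by apply: contra xy => /span_lie_eq0 ->// z; rewrite !inE => /orP[]/eqP->.
have -> : free [:: t; u] = free [:: u; t].
  by apply/perm_free; rewrite (perm_catC [:: t]).
by rewrite free_cons seq1_free t0 span_seq1 ut.
Qed.

(** [lie x] and [lie y] map [V] into the line of [z], so their common kernel
    in [V] has codimension at most 2 and is too large to be the line of [t]. *)
Lemma exists_commuting (V : {vspace g}) x y t z :
    x \in V -> y \in V -> t \in V -> (3 < \dim V)%N ->
    lie x y = z -> lie x t = 0 -> lie y t = 0 ->
    {in V, forall w, lie x w \in <[z]>%VS} ->
    {in V, forall w, lie y w \in <[z]>%VS} ->
  exists u, [/\ u \in V, u \notin <[t]>%VS, lie x u = 0 & lie y u = 0].
Proof.
move=> xV yV tV dimV xyz xt yt xz yz.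
have /subvPn[w wV wS] : ~~ (V <= <<[:: x; y; t]>>)%VS.
  apply: contraL dimV => /dimvS h; rewrite -leqNgt.
  exact: leq_trans h (dim_span _).
have /vlineP[a xw] := xz w wV; have /vlineP[b yw] := yz w wV.
(* As [lie x y = z], subtracting [a *: y] cancels [lie x w = a *: z], and as
   [lie y x = - z], adding [b *: x] cancels [lie y w = b *: z]. *)
exists (w - a *: y + b *: x); split.
- by rewrite rpredD ?rpredB ?rpredZ.
- apply: contra wS => /vlineP[c e].
  have -> : w = c *: t + a *: y - b *: x.
    by rewrite -e [_ + a *: y]addrAC subrK addrK.
  by rewrite rpredB ?rpredD ?rpredZ // memv_span // !inE eqxx ?orbT.
- by rewrite linearD linearB !linearZ /= xw xyz liexx scaler0 addr0
    scalerN subrr.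
- by rewrite linearD linearB !linearZ /= yw liexx oppr0 scaler0 addr0
    [lie y x]lieC xyz scalerN subrr.
Qed.

End LieAlgebraTheory.

Section Conjugation.
Context (R : rcfType).

Section Vector.
Context (V : vectType R).
Implicit Types w z : complexification V.

Lemma vconjK : involutive (@vconj R V).
Proof. by case=> u v; rewrite /vconj /= opprK. Qed.

Lemma vconj0 : vconj (0 : complexification V) = 0.
Proof. by congr pair; rewrite /= oppr0. Qed.

Lemma vconjD w z : vconj (w + z) = vconj w + vconj z.
Proof. by congr pair; rewrite /= opprD. Qed.

Lemma vconjZ (c : R[i]) w : vconj (c *: w) = conjc c *: vconj w.
Proof.
by case: c w => a b [u v]; congr pair;
  rewrite /= ?(scalerN, scaleNr, opprK, opprD).
Qed.

(** Conjugation is only semilinear over [R[i]], so it is not an ['End(_)] and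
    linear relations are transported with conjugated coefficients. *)
Lemma vconj_free n (X : n.-tuple (complexification V)) :
  free X -> free (map_tuple (@vconj R V) X).
Proof.
move=> /freeP freeX; apply/freeP => k k0 i.
apply/eqP; rewrite -conjc_eq0; apply/eqP.
apply: (freeX (fun i => conjc (k i))).
transitivity (vconj (\sum_(j < n) k j *: (map_tuple (@vconj R V) X)`_j));
  last by rewrite k0 vconj0.
rewrite (big_morph _ vconjD vconj0).
apply: eq_bigr => j _; rewrite vconjZ (nth_map 0) ?size_tuple//.
by rewrite vconjK.
Qed.

Lemma dimv_vconj (A B : {vspace complexification V}) :
  {in A, forall w, vconj w \in B} -> (\dim A <= \dim B)%N.
Proof.
move=> AB; have := vconj_free _ _ (basis_free (vbasisP A)).
rewrite /free size_tuple => /eqP <-; apply/dimvS/span_subvP => _ /mapP[w wA ->].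
exact/AB/vbasis_mem.
Qed.

End Vector.

Lemma lie_vconj (g : lieAlgebraType R) (w z : complexification g) :
  lie (vconj w) (vconj z) = vconj (lie w z).
Proof.
have lieNr (x y : g) : lie x (- y) = - lie x y by rewrite linearN.
have lieNl (x y : g) : lie (- x) y = - lie x y.
  by rewrite lieC lieNr [lie x y]lieC.
case: w z => [u v] [x y]; rewrite /lie /= /complexification_lie /vconj /=.
by rewrite !lieNl !lieNr opprK opprD.
Qed.

End Conjugation.

Section TypeDecomposition.
Context (R : rcfType) (g : lieAlgebraType R) (J : 'End(g)).
Implicit Types w : complexification g.

Lemma leigenspaceP (c : R[i]) w :
  reflect (complexify_lfun J w = c *: w)
          (w \in passmx.leigenspace (complexify_lfun J) c).
Proof.
rewrite memv_ker add_lfunE opp_lfunE scale_lfunE id_lfunE subr_eq0.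
exact: eqP.
Qed.

Lemma complexify_lfun_vconj w :
  complexify_lfun J (vconj w) = vconj (complexify_lfun J w).
Proof. by rewrite !lfunE; congr pair; rewrite /= linearN. Qed.

Lemma conjcNi : conjc (- 'i%C) = 'i%C :> R[i].
Proof. by congr Complex; rewrite ?oppr0 ?opprK. Qed.

Lemma vconj_g10 w : w \in g10 J -> vconj w \in g01 J.
Proof.
move/leigenspaceP => e; apply/leigenspaceP.
by rewrite complexify_lfun_vconj e vconjZ -[- 'i%C]conjcK conjcNi.
Qed.

Lemma vconj_g01 w : w \in g01 J -> vconj w \in g10 J.
Proof.
move/leigenspaceP => e; apply/leigenspaceP.
by rewrite complexify_lfun_vconj e vconjZ conjcNi.
Qed.

Lemma complexify_lfunK w : almost_complex J ->
  complexify_lfun J (complexify_lfun J w) = - w.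
Proof.
move=> /lfunP JJ.
have {}JJ x : J (J x) = - x.
  by have := JJ x; rewrite comp_lfunE opp_lfunE id_lfunE.
by rewrite !lfunE; congr pair; rewrite /= JJ.
Qed.

Lemma neq_iNi : 'i%C - - 'i%C != 0 :> R[i].
Proof.
by rewrite opprK eq_complex /= -(natrD _ 1 1) pnatr_eq0 andbF.
Qed.

Lemma g10_cap_g01 : (g10 J :&: g01 J = 0)%VS.
Proof.
apply/eqP; rewrite -subv0; apply/subvP => w.
rewrite memv_cap memv0 => /andP[/leigenspaceP wi /leigenspaceP].
rewrite wi => /eqP; rewrite -subr_eq0 -scalerBl scaler_eq0.
by rewrite (negPf neq_iNi).
Qed.

(** With [J^2 = -1], the eigencomponents of [w] are [(w - i J w) / 2] and
    [(w + i J w) / 2]; they appear below multiplied by [2 i] and divided by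
    [c = 2 i], which avoids inverting [i] separately. *)
Lemma g10_add_g01 : almost_complex J -> (g10 J + g01 J = fullv)%VS.
Proof.
move=> acJ; apply/eqP; rewrite eqEsubv subvf; apply/subvP => w _.
set c : R[i] := 'i%C - - 'i%C; set Jw := complexify_lfun J w.
have JJw : complexify_lfun J Jw = - w by exact: complexify_lfunK.
have ii : 'i%C * 'i%C = -1 :> R[i] by rewrite -expr2 sqr_i.
have -> : w = c^-1 *: ('i%C *: w + Jw) + c^-1 *: ('i%C *: w - Jw).
  rewrite -scalerDr addrACA subrr addr0 -scalerDl scalerA.
  by rewrite /c opprK mulVf ?scale1r // -[X in _ + X]opprK neq_iNi.
have Ji (v : complexification g) :
    complexify_lfun J ('i%C *: w + v) = 'i%C *: Jw + complexify_lfun J v.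
  by rewrite linearD linearZ.
rewrite memv_add // rpredZ //; apply/leigenspaceP; rewrite Ji.
  by rewrite JJw scalerDr scalerA ii scaleN1r addrC.
by rewrite linearN /= JJw scaleNr scalerBr scalerA ii scaleN1r opprB opprK.
Qed.

(** [g10] and [g01] are complementary, and conjugation exchanges them, so each
    takes up half of the complex dimension of [g (x) C]. *)
Lemma dim_g10 : almost_complex J -> (\dim (g10 J)).*2 = \dim {:g}.
Proof.
move=> acJ; have eqd : \dim (g10 J) = \dim (g01 J).
  apply/eqP; rewrite eqn_leq; apply/andP; split; apply: dimv_vconj => w.
    exact: vconj_g10.
  exact: vconj_g01.
rewrite -addnn {2}eqd -dimv_disjoint_sum; last exact: g10_cap_g01.
by rewrite (g10_add_g01 acJ) [LHS]dimvf [RHS]dimvf.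
Qed.

(** In the Jacobi identity of [conj W], [X], [Y] the brackets of [conj W] with
    [X] and [Y] are mixed, so only [lie (conj W) (lie X Y)] remains; it is the
    conjugate of the bracket to be computed. *)
Lemma vconj_lie_central X Y W : quasi_Kahler_Chern_flat J ->
  X \in g10 J -> Y \in g10 J -> W \in g10 J -> lie W (vconj (lie X Y)) = 0.
Proof.
move=> [mixed _] X10 Y10 W10; apply: (can_inj (@vconjK R g)).
rewrite -(lie_vconj R g W) vconjK vconj0; have W01 := vconj_g10 _ W10.
have XW : lie X (vconj W) = 0 by exact: mixed.
have YW : lie Y (vconj W) = 0 by exact: mixed.
have := lie_jacobi (vconj W) X Y.
rewrite YW [lie (vconj W) X]lieC XW oppr0.
by rewrite (linear0 (lie X)) (linear0 (lie Y)) !addr0.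
Qed.

Lemma not_integrable_lie_neq0 : ~ integrable J ->
  exists X Y, [/\ X \in g10 J, Y \in g10 J & lie X Y != 0].
Proof.
apply: contra_notP => noXY X Y X10 Y10; apply: contrapT => XY.
apply: noXY; exists X, Y; split=> //.
by apply: contra_notN XY => /eqP ->; exact: mem0v.
Qed.

End TypeDecomposition.

Theorem theorem4p5 (R : realType) (g : lieAlgebraType R) (J : 'End(g))
    (almost_complex_J : almost_complex J)
    (dim_g : \dim {:g} = (2 * 4)%N)
    (qKCf_J : quasi_Kahler_Chern_flat J)
    (non_complex_J : ~ integrable J) :
  exists Z : 4.-tuple (complexification g),
    [/\ basis_of (g10 J) Z,
        lie Z`_0 Z`_1 = vconj Z`_2 &
        forall i j : nat, (i < j < 4)%N -> (i, j) != (0%N, 1%N) ->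
          lie Z`_i Z`_j = 0].
Proof.
have dim4 : \dim (g10 J) = 4%N.
  by apply: double_inj; rewrite dim_g10.
have [X [Y [X10 Y10 XY0]]] := not_integrable_lie_neq0 _ _ _ non_complex_J.
pose T := vconj (lie X Y).
have conj10 A B : A \in g10 J -> B \in g10 J -> vconj (lie A B) \in g10 J.
  by move=> A10 B10; apply: vconj_g01; apply: qKCf_J.2.
have central A B C : A \in g10 J -> B \in g10 J -> C \in g10 J ->
  lie C (vconj (lie A B)) = 0 by exact: vconj_lie_central.
have T10 : T \in g10 J by exact: conj10.
have XT : lie X T = 0 by exact: central.
have YT : lie Y T = 0 by exact: central.
have T0 : T != 0.
  by apply: contra XY0 => /eqP T0; rewrite -[lie X Y]vconjK -/T T0 vconj0.
have vline A B : A \in g10 J -> B \in g10 J ->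
    vconj (lie A B) \in <[T]>%VS -> lie A B \in <[lie X Y]>%VS.
  move=> A10 B10 /vlineP[k e]; apply/vlineP; exists (conjc k).
  by rewrite -[LHS]vconjK e vconjZ vconjK.
have [U [U10 UT XU YU]] : exists U, [/\ U \in g10 J, U \notin <[T]>%VS,
    lie X U = 0 & lie Y U = 0].
  have [[A [B [A10 B10 AB]]]|noAB] := pselect (exists A B,
      [/\ A \in g10 J, B \in g10 J & vconj (lie A B) \notin <[T]>%VS]).
    by exists (vconj (lie A B)); split; rewrite ?central ?conj10.
  have inT A B : A \in g10 J -> B \in g10 J -> lie A B \in <[lie X Y]>%VS.
    move=> A10 B10; apply: vline => //; apply: contrapT => AB.
    by apply: noAB; exists A, B; split=> //; apply/negP.
  apply: (exists_commuting _ _ _ X Y T (lie X Y)) => //.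
  - by rewrite dim4.
  - by move=> W W10; apply: inT.
  - by move=> W W10; apply: inT.
have TU : lie T U = 0 by rewrite lieC central // oppr0.
exists [tuple X; Y; T; U]; split.
- rewrite basisEfree free_of_lie //= dim4 leqnn andbT.
  apply/span_subvP => Z; rewrite !inE.
  by case/or4P=> /eqP-> //; exact: conj10.
- by rewrite /= vconjK.
- by move=> [|[|[|i]]] [|[|[|[|j]]]] //= /andP[].
Qed.
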